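(* Let $\pi:(D,R_D)\to(X,R_X)$ be a Kripke sheaf, $(E,R_E)$ an event model with subsets $[\![\mathrm{Pre}(e)]\!]_\pi\subseteq X$ for $e\in E$, and fix $e\in E$ and $m,n\in\mathbb N$. For any monotone map $f:D^m_X\to D^n_X$ over $X$ (i.e. with $\pi^n\circ f=\pi^m$), writing $p_X^\ast f:D^m_{X\otimes E}\to D^n_{X\otimes E}$, $(\bar a,e')\mapsto(f(\bar a),e')$, we have the equalities of relations $$p_X^\ast f\circ R^m_e=R^n_e\circ f,\qquad (p_X^\ast f)^\dagger\circ R^n_e=R^m_e\circ f^\dagger .$$
   Context: Relations: functions are regarded as relations (their graphs), $\circ$ is relational composition ($a\,(S\circ R)\,c$ iff $aRbSc$ for some $b$), and $R^\dagger$ is the converse relation. A Kripke sheaf over a Kripke frame $(X,R_X)$ is a bounded morphism $\pi:(D,R_D)\to(X,R_X)$ (a function with $aR_Db\Rightarrow\pi(a)R_X\pi(b)$ and such that $\pi(a)R_Xw'$ implies $aR_Db$ for some $b$ with $\pi(b)=w'$) such that $aR_Db$, $aR_Db'$, $\pi(b)=\pi(b')$ imply $b=b'$. For $k\in\mathbb N$, $D^k_X=\{(a_1,\dots,a_k)\in D^k\mid\pi(a_1)=\dots=\pi(a_k)\}$ (with $D^0_X=X$), $\pi^k(\bar a)=\pi(a_i)$, and $\bar aR_{D^k_X}\bar b$ iff $a_iR_Db_i$ for all $i$. An event model is a Kripke frame $(E,R_E)$ with, for each $e\in E$, a precondition sentence $\mathrm{Pre}(e)$ interpreted as $[\![\mathrm{Pre}(e)]\!]_\pi\subseteq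 X$. Set $D^k_{X\otimes E}=\{(\bar a,e')\in D^k_X\times E\mid\pi^k(\bar a)\in[\![\mathrm{Pre}(e')]\!]_\pi\}$. For $e\in E$, let $i^k_e:(\pi^k)^{-1}[\![\mathrm{Pre}(e)]\!]_\pi\hookrightarrow D^k_X$ be the inclusion and $q^k_e:(\pi^k)^{-1}[\![\mathrm{Pre}(e)]\!]_\pi\to D^k_{X\otimes E}$, $\bar a\mapsto(\bar a,e)$; define the relation $R^k_e=q^k_e\circ(i^k_e)^\dagger\subseteq D^k_X\times D^k_{X\otimes E}$, i.e. $\bar a\,R^k_e\,(\bar b,e')$ iff $\bar a=\bar b$, $e'=e$ and $\pi^k(\bar a)\in[\![\mathrm{Pre}(e)]\!]_\pi$. *)

(* Defs.v *)
From mathcomp Require Import all_boot.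
From mathcomp Require Import boolp classical_sets.

Set Implicit Arguments.
Unset Strict Implicit.
Unset Printing Implicit Defensive.

Local Open Scope classical_set_scope.

(* A relation from A to B is a [set (A * B)], and [S \; R] (the relation [R]
   first) and [R^-1] are the composite and converse of [relation_scope]. *)

Record kframe := KFrame {
  kworld :> Type ;
  kacc : kworld -> kworld -> Prop }.

Definition monotone (F G : kframe) (f : F -> G) : Prop :=
  forall a b : F, kacc a b -> kacc (f a) (f b).

Definition bounded_morphism (F G : kframe) (f : F -> G) : Prop :=
  monotone f /\
  forall (a : F) (w : G), kacc (f a) w -> exists2 b : F, kacc a b & f b = w.

Definition kripke_sheaf (D X : kframe) (pi : D -> X) : Prop :=
  bounded_morphism pi /\
  forall a b b' : D, kacc a b -> kacc a b' -> pi b = pi b' -> b = b'.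

(* The k-fold fibered power of D over X. For k = 0 it is the frame X itself,
   so its relation is that of X, not the (vacuous) componentwise one. *)
Definition fpower (D X : kframe) (pi : D -> X) (k : nat) : kframe :=
  match k with
  | 0 => X
  | k'.+1 =>
    @KFrame
      [set a : k'.+1.-tuple D | forall i j, pi (tnth a i) = pi (tnth a j)]
      (fun a b => forall i, kacc (tnth (val a) i) (tnth (val b) i))
  end.

(* The choice of the first component is immaterial: all have the same image. *)
Definition fproj (D X : kframe) (pi : D -> X) (k : nat) : fpower pi k -> X :=
  match k return fpower pi k -> X with
  | 0 => id
  | k'.+1 => fun a => pi (thead (val a))
  end.

Arguments fproj {D X} pi k.

(* Preconditions are given by their interpretations as sets of worlds of X. *)
Record event_model (X : kframe) := EventModel {
  event_frame :> kframe ;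
  pre : event_frame -> set X }.

Section Update.
Variables (D X : kframe) (pi : D -> X) (E : event_model X).

Definition fprod (k : nat) : Type :=
  [set p : fpower pi k * E | pre p.2 (fproj pi k p.1)].

Definition pre_fiber (k : nat) (e : E) : set (fpower pi k) :=
  fproj pi k @^-1` pre e.

Arguments pre_fiber : clear implicits.

Definition pre_incl (k : nat) (e : E) : pre_fiber k e -> fpower pi k := val.

Lemma pre_pair_subproof (k : nat) (e : E) (a : pre_fiber k e) :
  (val a, e) \in [set p : fpower pi k * E | pre p.2 (fproj pi k p.1)].
Proof. by apply/mem_set; exact: (set_mem (valP a)). Qed.

Definition pre_pair (k : nat) (e : E) (a : pre_fiber k e) : fprod k :=
  exist _ (val a, e) (pre_pair_subproof a).

Arguments pre_incl : clear implicits.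
Arguments pre_pair : clear implicits.

Definition graph (A B : Type) (f : A -> B) : set (A * B) :=
  [set xy | f xy.1 = xy.2].

Definition update_rel (k : nat) (e : E) : set (fpower pi k * fprod k) :=
  (graph (pre_pair k e) \; (graph (pre_incl k e))^-1)%relation.

Variables (m n : nat) (f : fpower pi m -> fpower pi n).
Hypothesis f_over : fproj pi n \o f =1 fproj pi m.

Lemma pullback_subproof (p : fprod m) :
  (f (val p).1, (val p).2) \in [set p : fpower pi n * E | pre p.2 (fproj pi n p.1)].
Proof.
by apply/mem_set; rewrite /= [fproj _ _ _]f_over; exact: (set_mem (valP p)).
Qed.

Definition pullback_map (p : fprod m) : fprod n :=
  exist _ (f (val p).1, (val p).2) (pullback_subproof p).

End Update.

Arguments update_rel {D X} pi {E} k e.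
Arguments pullback_map {D X pi} E {m n f} f_over p.

(* Main.v *)
Require Import Defs.
From mathcomp Require Import all_boot.
From mathcomp Require Import boolp classical_sets.

(** [update_rel pi k e] links [a] to the point [(a, e)] exactly when that point exists. Hence both
    sides of the first equality say [val q = (f a, e)], and both sides of the second say
    [val q = (b, e)] for some [b] with [f b = a]. Since [f] is over [X], [a] and [f a] project to
    the same world, so [pre e] holds at both or at neither. *)

Lemma update_relE (D X : kframe) (pi : D -> X) (E : event_model X) (k : nat)
    (e : E) (a : fpower pi k) (p : Defs.fprod pi E k) :
  update_rel pi k e (a, p) <-> val p = (a, e).
Proof.
split=> [|vp].
  by case=> c; rewrite /graph /= => <- <-.
(* As a point of [fprod], [p] carries the precondition at [a], which yields the witness in the
   fiber. *)
have pre_a : a \in pre_fiber e.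
  by have := set_mem (valP p); rewrite vp => pre_a; apply/mem_set.
by exists (exist _ a pre_a) => //=; apply: val_inj.
Qed.

Theorem theorem4p6 (D X : kframe) (pi : D -> X) (pi_sheaf : kripke_sheaf pi)
    (E : event_model X) (e : E) (m n : nat)
    (f : fpower pi m -> fpower pi n) (f_mono : monotone f)
    (f_over : fproj pi n \o f =1 fproj pi m) :
  (graph (pullback_map E f_over) \; update_rel pi m e
     = update_rel pi n e \; graph f)%relation
  /\
  ((graph (pullback_map E f_over))^-1 \; update_rel pi n e
     = update_rel pi m e \; (graph f)^-1)%relation.
Proof.
split; apply/seteqP; split=> -[a q]; rewrite /graph /=.
- case=> p /= /update_relE vp <-; exists (f a) => //=.
  by apply/update_relE; rewrite /= vp.
- case=> b /= <- /update_relE vq.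
  (* [q] carries the precondition at [f a]; [f_over] brings it back to [a], so the intermediate
     point exists. *)
  have pre_a : (a, e) \in [set p : fpower pi m * E | pre p.2 (fproj pi m p.1)]%classic.
    by have := set_mem (valP q); rewrite vq => pre_fa; apply/mem_set;
      rewrite /= -f_over.
  exists (exist _ (a, e) pre_a) => /=; first exact/update_relE.
  exact: val_inj.
(* Among the possible preimages of [a] under [f], the right one is read off [q]. *)
- case=> p /= /update_relE vp qp; exists (val q).1 => /=.
    by move: vp; rewrite -qp => -[].
  by apply/update_relE; move: vp; rewrite -qp /=; case: (val q) => ? ? /= [_ ->].
- case=> b /= fb /update_relE vq; exists (pullback_map E f_over q) => //=.
  by apply/update_relE; rewrite /= vq fb.
Qed.
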